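(* The following upper bounds hold: $$m(8) \leq 1212,\quad m(13) \leq 200889,\quad m(14) \leq 528218,\quad m(16) \leq 3308499,\quad m(17) \leq 10375782.$$
   Context: A hypergraph $H=(V,E)$ consists of a finite vertex set $V$ and a set $E$ of subsets of $V$ (hyperedges); it is $n$-uniform if every hyperedge has exactly $n$ vertices. A 2-coloring of $H$ assigns one of two colors (red, blue) to each vertex; it is proper if no hyperedge is monochromatic. $H$ is non-2-colorable if it has no proper 2-coloring. For an integer $n \geq 1$, $m(n)$ denotes the minimum number of hyperedges in a non-2-colorable $n$-uniform hypergraph. *)

(* Defs.v *)
From mathcomp Require Import all_boot boolp.

Set Implicit Arguments.
Unset Strict Implicit.
Unset Printing Implicit Defensive.

(* [boolp] is used only to take a minimum over a [Prop]. *)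

Record hypergraph := Hypergraph {
  vertex : finType;
  edges : {set {set vertex}} }.

Definition uniform (n : nat) (H : hypergraph) : Prop :=
  forall e, e \in edges H -> #|e| = n.

(* A 2-coloring is an arbitrary map to [bool], the two colors being the two
   booleans. *)
Definition monochromatic (V : finType) (c : V -> bool) (e : {set V}) : Prop :=
  exists b : bool, forall v, v \in e -> c v = b.

Definition proper_2coloring (H : hypergraph) (c : vertex H -> bool) : Prop :=
  forall e, e \in edges H -> ~ monochromatic c e.

Definition two_colorable (H : hypergraph) : Prop :=
  exists c : vertex H -> bool, proper_2coloring c.

Definition non_2colorable_size (n k : nat) : Prop :=
  exists H : hypergraph,
    [/\ uniform n H, ~ two_colorable H & #|edges H| = k].

(* Witness: the complete [n]-uniform hypergraph on [2 * n] vertices. *)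
Lemma non_2colorable_size_ex (n : nat) :
  exists k, `[< non_2colorable_size n k >].
Proof.
pose H := Hypergraph [set e : {set 'I_(n + n)} | #|e| == n].
exists #|edges H|; apply/asboolP; exists H; split=> //.
  by move=> e; rewrite inE => /eqP.
move=> [c cP].
have [b nb] : exists b, n <= #|[set v | c v == b]|.
  have [|ltn] := leqP n #|[set v | c v == true]|; first by exists true.
  exists false; rewrite -(leq_add2l n).
  have -> : [set v | c v == false] = ~: [set v | c v == true].
    by apply/setP=> v; rewrite !inE; case: (c v).
  by rewrite -{1}(card_ord (n + n)) -(cardsC [set v | c v == true]) leq_add2r ltnW.
have /card_geqP [s [us sn ss]] := nb.
apply: (cP [set x in s]).
  by rewrite inE cardsE (card_uniqP us) sn.
by exists b => v; rewrite inE => /ss; rewrite inE => /eqP.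
Qed.

(* The least number of edges of a non-2-colorable [n]-uniform hypergraph, over
   hypergraphs on any finite vertex type. *)
Definition m (n : nat) : nat := ex_minn (non_2colorable_size_ex n).

(* Main.v *)
Require Import Defs.
From mathcomp Require Import all_boot.
From Stdlib Require Import PeanoNat.
From mathcomp Require Import boolp zify.

(* Take a non-2-colorable p-uniform hypergraph C and a non-2-colorable
   q-uniform one K, with p + q = n.  The edges e + f force monochromatic edges
   of C and K to have opposite colors, say red and blue.  It remains to add
   vertices with q-sets (joined to C) and p-sets (joined to K) such that every
   coloring has a red q-set or a blue p-set; such pairs of families are built
   by series-parallel composition.  This gives the bounds for n = 8, 13, 14
   and 17 from m(3) <= 7, m(5) <= 51 and m(9) <= 2401, which come from the
   Abbott-Hanson construction with blocks in place of vertices.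

   For n = 16, the Abbott-Hanson construction uses a core of uniformity 10 and
   five pairs of blocks.  Blocks of uniformity 3 give pairs of size 16 - 10 but
   transversals of size 15 only.  So the last pair uses 4-uniform blocks for
   the transversals, each with an accompanying 3-uniform hypergraph for the
   pairs, which has a monochromatic edge of the same color. *)

Set Implicit Arguments.
Unset Strict Implicit.
Unset Printing Implicit Defensive.

(** * Uniform families, monochromatic edges and joins over disjoint vertex sets *)

Definition is_family (V : finType) (n k : nat) (F : {set {set V}}) : Prop :=
  (forall e, e \in F -> #|e| = n) /\ #|F| <= k.

Definition has_mono (V : finType) (c : V -> bool) (b : bool)
    (F : {set {set V}}) : Prop :=
  exists2 e, e \in F & forall v, v \in e -> c v = b.

Definition join (V W : finType) (F : {set {set V}}) (G : {set {set W}}) :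
    {set {set (V + W)}} :=
  [set (inl @: e) :|: (inr @: f) | e : {set V} in F, f : {set W} in G].

Lemma eq_or_negb (b c : bool) : c = b \/ c = ~~ b.
Proof. by case: b c => -[]; [left | right | right | left]. Qed.

Lemma is_family0 (V : finType) (n : nat) : is_family n 0 (set0 : {set {set V}}).
Proof. by split=> [e|]; rewrite ?inE ?cards0. Qed.

Lemma is_family1 (V : finType) (e : {set V}) : is_family #|e| 1 [set e].
Proof. by split=> [f|]; rewrite ?cards1 // inE => /eqP->. Qed.

Lemma is_family_setT (V : finType) : is_family #|V| 1 [set [set: V]].
Proof. by have := is_family1 [set: V]; rewrite cardsT. Qed.

Lemma is_family_unit (V : finType) : is_family 0 1 [set set0 : {set V}].
Proof. by have := is_family1 (set0 : {set V}); rewrite cards0. Qed.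

Lemma is_familyU (V : finType) (n k l : nat) (F G : {set {set V}}) :
  is_family n k F -> is_family n l G -> is_family n (k + l) (F :|: G).
Proof.
move=> [nF kF] [nG lG]; split; first by move=> e /setUP [/nF|/nG].
by rewrite (leq_trans (leq_card_setU _ _)) // leq_add.
Qed.

Lemma is_family_join (V W : finType) (n n' k l : nat)
    (F : {set {set V}}) (G : {set {set W}}) :
  is_family n k F -> is_family n' l G -> is_family (n + n') (k * l) (join F G).
Proof.
move=> [nF kF] [nG lG]; split.
  move=> _ /imset2P [e f /nF <- /nG <- ->].
  rewrite cardsU (_ : _ :&: _ = set0) ?cards0 ?subn0; last first.
    apply/setP=> x; rewrite !inE; apply/negP => /andP [/imsetP [v _ ->]].
    by case/imsetP.
  by rewrite !card_imset //; [apply: inr_inj | apply: inl_inj].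
rewrite /join curry_imset2X.
by rewrite (leq_trans (leq_imset_card _ _)) // cardsX leq_mul.
Qed.

Lemma has_mono1 (V : finType) (c : V -> bool) (b : bool) (e : {set V}) :
  (forall v, v \in e -> c v = b) -> has_mono c b [set e].
Proof. by move=> ce; exists e => //; rewrite inE. Qed.

Lemma has_mono_unit (V : finType) (c : V -> bool) (b : bool) :
  has_mono c b [set set0].
Proof. by apply: has_mono1 => v; rewrite inE. Qed.

Lemma has_monoUl (V : finType) (c : V -> bool) (b : bool) (F G : {set {set V}}) :
  has_mono c b F -> has_mono c b (F :|: G).
Proof. by move=> [e eF ce]; exists e => //; rewrite inE eF. Qed.

Lemma has_monoUr (V : finType) (c : V -> bool) (b : bool) (F G : {set {set V}}) :
  has_mono c b G -> has_mono c b (F :|: G).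
Proof. by rewrite setUC; apply: has_monoUl. Qed.

Lemma has_mono_join (V W : finType) (c : V + W -> bool) (b : bool)
    (F : {set {set V}}) (G : {set {set W}}) :
  has_mono (c \o inl) b F -> has_mono (c \o inr) b G -> has_mono c b (join F G).
Proof.
move=> [e eF ce] [f fG cf]; exists (inl @: e :|: inr @: f).
  by apply/imset2P; exists e f.
by move=> _ /setUP [] /imsetP [v vI ->]; [apply: ce | apply: cf].
Qed.

(** The copy of [F] in the sum, encoded as a join with the empty edge, which is monochromatic in
    both colors, so that the facts about [join] apply. *)
Definition liftl (V W : finType) (F : {set {set V}}) : {set {set (V + W)}} :=
  join F [set set0].

Definition liftr (V W : finType) (G : {set {set W}}) : {set {set (V + W)}} :=
  join [set set0] G.

Lemma is_family_liftl (V W : finType) (n k : nat) (F : {set {set V}}) :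
  is_family n k F -> is_family n k (liftl W F).
Proof.
by move=> /is_family_join /(_ (is_family_unit W)); rewrite addn0 muln1.
Qed.

Lemma is_family_liftr (V W : finType) (n k : nat) (G : {set {set W}}) :
  is_family n k G -> is_family n k (liftr V G).
Proof.
by move=> /(is_family_join (is_family_unit V)); rewrite add0n mul1n.
Qed.

Lemma has_mono_liftl (V W : finType) (c : V + W -> bool) (b : bool)
    (F : {set {set V}}) :
  has_mono (c \o inl) b F -> has_mono c b (liftl W F).
Proof. by move=> Fb; apply: has_mono_join => //; apply: has_mono_unit. Qed.

Lemma has_mono_liftr (V W : finType) (c : V + W -> bool) (b : bool)
    (G : {set {set W}}) :
  has_mono (c \o inr) b G -> has_mono c b (liftr V G).
Proof. by move=> Gb; apply: has_mono_join => //; apply: has_mono_unit. Qed.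

Lemma has_mono_negb (V : finType) (c : V -> bool) (b : bool) (F : {set {set V}}) :
  has_mono (negb \o c) b F -> has_mono c (~~ b) F.
Proof. by move=> [e eF ce]; exists e => // v /ce <- /=; rewrite negbK. Qed.

(** * Non-2-colorable hypergraphs and the link to [m] *)

Definition uncolorable (n k : nat) : Prop :=
  exists (V : finType) (F : {set {set V}}),
    is_family n k F /\ forall c, exists b, has_mono c b F.

Lemma uncolorable_leq (n k l : nat) :
  uncolorable n k -> k <= l -> uncolorable n l.
Proof.
move=> [V [F [[nF kF] monoF]]] kl; exists V, F; split=> //.
by split=> //; apply: leq_trans kl.
Qed.

Lemma m_le (n k : nat) : uncolorable n k -> m n <= k.
Proof.
move=> [V [F [[nF kF] monoF]]]; rewrite /m; case: ex_minnP => j _ minj.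
apply: leq_trans kF; apply: minj; apply/asboolP; exists (Hypergraph F).
split=> // -[c cP]; have [b [e eF ce]] := monoF c.
by apply: (cP e eF); exists b.
Qed.

Lemma uncolorable1 : uncolorable 1 1.
Proof.
exists unit, [set setT]; split.
  by have := is_family_setT unit; rewrite card_unit.
by move=> c; exists (c tt); apply: has_mono1 => -[].
Qed.

(** * Series-parallel composition of red-blue pairs of families *)

Definition cross (s t a b : nat) : Prop :=
  exists (V : finType) (R B : {set {set V}}),
    [/\ is_family s a R, is_family t b B &
        forall c, has_mono c true R \/ has_mono c false B].

Lemma cross_sym (s t a b : nat) : cross s t a b -> cross t s b a.
Proof.
move=> [V [R [B [famR famB RB]]]]; exists V, B, R; split=> // c.
by case: (RB (negb \o c)) => /has_mono_negb; [right | left].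
Qed.

Lemma cross_uncolorable (n k : nat) : uncolorable n k -> cross n n k k.
Proof.
move=> [V [F [famF monoF]]]; exists V, F, F; split=> // c.
by have [[] Fb] := monoF c; [left | right].
Qed.

(** A red edge in either of the two disjoint copies suffices; if both copies lack one, each has a
    blue edge, and these two are joined. *)
Lemma cross_or (s t t' a a' b b' : nat) :
  cross s t a b -> cross s t' a' b' -> cross s (t + t') (a + a') (b * b').
Proof.
move=> [V [R [B [famR famB RB]]]] [V' [R' [B' [famR' famB' RB']]]].
exists (V + V')%type, (liftl V' R :|: liftr V R'), (join B B'); split.
- by apply: is_familyU; [apply: is_family_liftl | apply: is_family_liftr].
- exact: is_family_join.
move=> c; have [Rc|Bc] := RB (c \o inl).
  by left; apply/has_monoUl/has_mono_liftl.
have [Rc'|Bc'] := RB' (c \o inr).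
  by left; apply/has_monoUr/has_mono_liftr.
by right; apply: has_mono_join.
Qed.

Lemma cross_and (s s' t a a' b b' : nat) :
  cross s t a b -> cross s' t a' b' -> cross (s + s') t (a * a') (b + b').
Proof. by move=> /cross_sym X /cross_sym Y; apply/cross_sym/cross_or. Qed.

Lemma uncolorable_core (p q k l a b : nat) :
  uncolorable p k -> uncolorable q l -> cross q p a b ->
  uncolorable (p + q) (k * l + k * a + l * b).
Proof.
move=> [V [F [famF monoF]]] [W [G [famG monoG]]] [U [R [B [famR famB RB]]]].
exists (V + (W + U))%type,
  (join F (liftl U G) :|: join F (liftr W R) :|: liftr V (join G B)); split.
  apply: is_familyU; first apply: is_familyU.
  - by apply/is_family_join/is_family_liftl.
  - by apply/is_family_join/is_family_liftr.
  - by rewrite addnC; apply/is_family_liftr/is_family_join.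
move=> c; have [x Fx] := monoF (c \o inl).
have [y Gy] := monoG (c \o inr \o inl).
have [yE|yE] := eq_or_negb x y.
  rewrite yE in Gy; exists x.
  by do 2!apply: has_monoUl; apply/has_mono_join/has_mono_liftl.
(* [RB] fixes red for [R] and blue for [B]; if [x] is [false], it is applied to the complementary
   coloring. *)
have [Rx|By] : has_mono (c \o inr \o inr) x R \/ has_mono (c \o inr \o inr) y B.
  rewrite yE; case: x {Fx yE} => /=; first exact: RB.
  by case: (RB (negb \o (c \o inr \o inr))) => /has_mono_negb; [left | right].
  exists x; apply/has_monoUl/has_monoUr.
  by apply/has_mono_join/has_mono_liftr.
by exists y; apply/has_monoUr/has_mono_liftr/has_mono_join.
Qed.

(** * Blocks, pairs of blocks and the Abbott-Hanson construction *)

Definition twin (w t k l : nat) : Prop :=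
  exists (V : finType) (F G : {set {set V}}),
    [/\ is_family w k F, is_family t l G &
        forall c, exists b, has_mono c b F /\ has_mono c b G].

Lemma twin_uncolorable (n k : nat) : uncolorable n k -> twin n n k k.
Proof.
move=> [V [F [famF monoF]]]; exists V, F, F; split=> // c.
by have [b Fb] := monoF c; exists b.
Qed.

(** Add [n.+1] new points. If one of them has the color [b] of a monochromatic edge of [F], it
    extends that edge. Otherwise all have color [~~ b], and so do the set of all new points and its
    [n]-subset that omits [ord0]. *)
Lemma twinS (n k : nat) :
  uncolorable n k -> twin n n.+1 (k + 1) (k * n.+1 + 1).
Proof.
move=> [V [F [famF monoF]]].
pose pts := [set [set i] | i : 'I_n.+1].
have famP : is_family 1 n.+1 pts.
  split=> [_ /imsetP [i _ ->]|]; first by rewrite cards1.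
  by rewrite (leq_trans (leq_imset_card _ _)) // card_ord.
have famT : is_family n.+1 1 [set [set: 'I_n.+1]].
  by have := is_family_setT 'I_n.+1; rewrite card_ord.
have famI : is_family n 1 [set [set~ ord0 : 'I_n.+1]].
  by have := is_family1 [set~ ord0 : 'I_n.+1]; rewrite cardsC1 card_ord.
exists (V + 'I_n.+1)%type,
  (liftl 'I_n.+1 F :|: liftr V [set [set~ ord0]]),
  (join F pts :|: liftr V [set [set: 'I_n.+1]]); split.
- by apply: is_familyU; [apply: is_family_liftl | apply: is_family_liftr].
- apply: is_familyU; last exact: is_family_liftr.
  by have := is_family_join famF famP; rewrite addn1.
move=> c; have [b Fb] := monoF (c \o inl).
have [[i ci]|noi] := pselect (exists i : 'I_n.+1, c (inr i) = b).
  exists b; split; apply: has_monoUl; first exact: has_mono_liftl.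
  apply: has_mono_join => //; exists [set i]; first exact: imset_f.
  by move=> _ /set1P ->.
have ci (i : 'I_n.+1) : c (inr i) = ~~ b.
  by have [ci|] := eq_or_negb b (c (inr i)) => //; case: noi; exists i.
exists (~~ b).
by split; apply/has_monoUr/has_mono_liftr/has_mono1 => v _; apply: ci.
Qed.

(* [D] collects the pairs and [T i] the transversals of parity [i] of [r] pairs
   of blocks, the two blocks of a pair being copies of one [twin]. *)
Definition ladder (r w t d k0 k1 : nat) : Prop :=
  exists (V : finType) (D : {set {set V}}) (T : bool -> {set {set V}}),
    [/\ is_family w d D, is_family t k0 (T false), is_family t k1 (T true) &
      forall c b, [\/ has_mono c b D, forall i, has_mono c (~~ b) (T i) |
        exists i, has_mono c (~~ b) (T i) /\ has_mono c b (T (i (+) odd r))]].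

Lemma ladder0 (w : nat) : ladder 0 w 0 0 1 0.
Proof.
exists void, set0, (fun i => if i then set0 else [set set0]).
split; [exact: is_family0 | exact: is_family_unit | exact: is_family0 |].
by move=> c b; apply: Or33; exists false; split; apply: has_mono_unit.
Qed.

(** A transversal continues through the left block, keeping its parity, or through the right one,
    flipping it. If the blocks have different colors, two complementary transversals continue
    through different blocks, which flips their relative parity. If both blocks have color [~~ b],
    both parities get that color; if both have color [b], so does an edge of [join F F]. *)
Lemma ladderS (r w t t' d k0 k1 k l : nat) :
  ladder r (w + w) t d k0 k1 -> twin w t' k l ->
  ladder r.+1 (w + w) (t + t') (d + k * k) (k0 * l + k1 * l) (k1 * l + k0 * l).
Proof.
move=> [V [D [T [famD famT0 famT1 monoT]]]] [W [F [G [famF famG monoFG]]]].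
pose T' i := join (T i) (liftl W G) :|: join (T (~~ i)) (liftr W G).
exists (V + (W + W))%type, (liftl _ D :|: liftr _ (join F F)), T'; split.
- apply: is_familyU; first exact: is_family_liftl.
  by apply/is_family_liftr/is_family_join.
- by apply: is_familyU; apply: is_family_join => //;
    [apply: is_family_liftl | apply: is_family_liftr].
- by apply: is_familyU; apply: is_family_join => //;
    [apply: is_family_liftl | apply: is_family_liftr].
move=> c b.
have [x [Fx Gx]] := monoFG (c \o inr \o inl).
have [y [Fy Gy]] := monoFG (c \o inr \o inr).
have monoX i : has_mono (c \o inl) x (T i) -> has_mono c x (T' i).
  by move=> Ti; apply/has_monoUl/has_mono_join/has_mono_liftl.
have monoY i : has_mono (c \o inl) y (T i) -> has_mono c y (T' (~~ i)).
  by move=> Ti; apply/has_monoUr; rewrite negbK; apply/has_mono_join/has_mono_liftr.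
have [Db|Tall|[i [Ti Tj]]] := monoT (c \o inl) b;
  first by apply: Or31; apply/has_monoUl/has_mono_liftl.
all: have [xE|xE] := eq_or_negb b x; have [yE|yE] := eq_or_negb b y; subst x y.
all: try by apply: Or31; apply/has_monoUr/has_mono_liftr/has_mono_join.
(* In the three cases left from [Tall], one block of color [~~ b] extends both parities. *)
- by apply: Or32 => i; rewrite -[i]negbK; apply: monoY.
- by apply: Or32 => i; apply: monoX.
- by apply: Or32 => i; apply: monoX.
- apply: Or33; exists (~~ i); split; first exact: monoY.
  by rewrite /= addNb addbN negbK; apply: monoX.
- apply: Or33; exists i; split; first exact: monoX.
  by rewrite /= addbN; apply: monoY.
apply: Or32 => j; have [->|ji] := eqVneq j i; first exact: monoX.
by have -> : j = ~~ i; [case: j i ji {Ti Tj} => -[] | apply: monoY].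
Qed.

(* The Abbott-Hanson construction: if no pair has the color of the core, then
   either both parities of transversals have the opposite color, or some
   transversal and its complement are monochromatic; as [r] is odd, these
   two have different parities. *)
Lemma uncolorable_ladder (r w t d k0 k1 p k : nat) :
  ladder r w t d k0 k1 -> odd r -> uncolorable p k -> p + w = t ->
  uncolorable t (k * d + k0).
Proof.
move=> [V [D [T [famD famT0 _ monoT]]]] odd_r [W [F [famF monoF]]] tE.
exists (W + V)%type, (join F D :|: liftr W (T false)); split.
  apply: is_familyU; last exact: is_family_liftr.
  by rewrite -tE; apply: is_family_join.
move=> c; have [b Fb] := monoF (c \o inl).
have [Db|Tall|[i [Ti Tj]]] := monoT (c \o inr) b.
- by exists b; apply/has_monoUl/has_mono_join.
- by exists (~~ b); apply/has_monoUr/has_mono_liftr.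
rewrite odd_r in Tj.
by case: i Ti Tj => Ti Tj; [exists b | exists (~~ b)];
  apply/has_monoUr/has_mono_liftr.
Qed.

(** * Explicit small cases and the five bounds *)

Lemma cross11 : cross 1 1 1 1.
Proof. exact: cross_uncolorable uncolorable1. Qed.

Lemma cross12 : cross 1 2 2 1.
Proof. exact: cross_or cross11 cross11. Qed.

(* Red sets: a pair and the four edges of a disjoint 4-cycle. *)
Lemma cross23 : cross 2 3 5 4.
Proof. exact: cross_or (cross_sym cross12) (cross_and cross12 cross12). Qed.

(** A different trade-off from [cross_sym cross23], whose sizes are 4 and 5. *)
Lemma cross32 : cross 3 2 8 3.
Proof. exact: cross_and cross12 (cross_and cross12 cross12). Qed.

(** This is the Fano plane: three lines through the core vertex and four even transversals. *)
Lemma uncolorable3 : uncolorable 3 7.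
Proof.
have B := twin_uncolorable uncolorable1.
have L := ladderS (ladderS (ladderS (ladder0 (1 + 1)) B) B) B.
exact: uncolorable_ladder L isT uncolorable1 _.
Qed.

Lemma cross33 : cross 3 3 7 7.
Proof. exact: cross_uncolorable uncolorable3. Qed.

Lemma uncolorable5 : uncolorable 5 51.
Proof.
have B := twin_uncolorable uncolorable1.
have L := ladderS (ladderS (ladderS (ladderS (ladderS (ladder0 (1 + 1))
  B) B) B) B) B.
exact: uncolorable_ladder L isT uncolorable3 _.
Qed.

Lemma cross55 : cross 5 5 51 51.
Proof. exact: cross_uncolorable uncolorable5. Qed.

Lemma uncolorable8 : uncolorable 8 1163.
Proof.
exact: uncolorable_core uncolorable3 uncolorable5 (cross_and cross23 cross33).
Qed.

Lemma uncolorable9 : uncolorable 9 2401.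
Proof.
have B := twin_uncolorable uncolorable3.
have L := ladderS (ladderS (ladderS (ladder0 (3 + 3)) B) B) B.
exact: uncolorable_ladder L isT uncolorable3 _.
Qed.

Lemma uncolorable13 :
  uncolorable 13 (51 * 1163 + 51 * (15 * 51) + 1163 * (21 + 51)).
Proof.
have x35 : cross 3 5 15 21 := cross_or cross32 cross33.
exact: uncolorable_core uncolorable5 uncolorable8 (cross_and x35 cross55).
Qed.

Lemma uncolorable14 :
  uncolorable 14 (51 * 2401 + 51 * (37 * 51) + 2401 * (32 + 51)).
Proof.
have x42 : cross 4 2 16 4 := cross_and cross12 cross32.
have x43 : cross 4 3 21 8 := cross_and (cross_or cross11 cross12) cross33.
have x45 : cross 4 5 37 32 := cross_or x42 x43.
exact: uncolorable_core uncolorable5 uncolorable9 (cross_and x45 cross55).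
Qed.

(** The core has three joins of [51 * 51] edges each. The last pair of blocks adds
    [64 = (7 + 1) * (7 + 1)] to the pairs, and its transversal blocks have [29 = 7 * 4 + 1]
    edges. *)
Lemma uncolorable16 :
  uncolorable 16 (3 * (51 * 51) * (4 * 49 + 64) + 16 * (49 * 49 * 29)).
Proof.
have core := uncolorable_core uncolorable5 uncolorable5 cross55.
have B := twin_uncolorable uncolorable3.
have L := ladderS (ladderS (ladderS (ladderS (ladderS (ladder0 (3 + 3))
  B) B) B) B) (twinS uncolorable3).
have U := uncolorable_ladder L isT core (erefl 16).
by apply: uncolorable_leq U _; lia.
Qed.

Lemma uncolorable17 :
  uncolorable 17 (1163 * 2401 + 1163 * (18 * 170) + 2401 * (245 + 980)).
Proof.
have x38 : cross 3 8 18 245.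
  exact: cross_or (cross_sym cross23) (cross_or cross33 cross33).
have x35 : cross 3 5 11 35 := cross_or (cross_sym cross23) cross33.
have x68 : cross 6 8 170 980.
  exact: cross_or (cross_and cross33 cross33) (cross_and x35 x35).
exact: uncolorable_core uncolorable8 uncolorable9 (cross_and x38 x68).
Qed.

(* Numerals above 5000 are parsed as [Nat.of_num_uint], which [lia] treats as
   opaque; this puts them in Horner form without computing in unary. *)
Lemma of_uint_acc_rec (d : Decimal.uint) (k : nat) :
  (Nat.of_uint_acc (Decimal.D0 d) k = Nat.of_uint_acc d (10 * k)) *
  (Nat.of_uint_acc (Decimal.D1 d) k = Nat.of_uint_acc d (10 * k + 1)) *
  (Nat.of_uint_acc (Decimal.D2 d) k = Nat.of_uint_acc d (10 * k + 2)) *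
  (Nat.of_uint_acc (Decimal.D3 d) k = Nat.of_uint_acc d (10 * k + 3)) *
  (Nat.of_uint_acc (Decimal.D4 d) k = Nat.of_uint_acc d (10 * k + 4)) *
  (Nat.of_uint_acc (Decimal.D5 d) k = Nat.of_uint_acc d (10 * k + 5)) *
  (Nat.of_uint_acc (Decimal.D6 d) k = Nat.of_uint_acc d (10 * k + 6)) *
  (Nat.of_uint_acc (Decimal.D7 d) k = Nat.of_uint_acc d (10 * k + 7)) *
  (Nat.of_uint_acc (Decimal.D8 d) k = Nat.of_uint_acc d (10 * k + 8)) *
  (Nat.of_uint_acc (Decimal.D9 d) k = Nat.of_uint_acc d (10 * k + 9)).
Proof.
do !apply: pair; rewrite //= Nat.tail_mul_spec;
  by congr (Nat.of_uint_acc _ _); lia.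
Qed.

Theorem mainTheorem5 :
  [/\ m 8 <= 1212,
      m 13 <= 200889,
      m 14 <= 528218,
      m 16 <= 3308499
    & m 17 <= 10375782].
Proof.
split; first by apply: leq_trans (m_le uncolorable8) _; lia.
all: rewrite /Nat.of_num_uint /Nat.of_uint !of_uint_acc_rec /=.
- by apply: leq_trans (m_le uncolorable13) _; lia.
- by apply: leq_trans (m_le uncolorable14) _; lia.
- by apply: leq_trans (m_le uncolorable16) _; lia.
by apply: leq_trans (m_le uncolorable17) _; lia.
Qed.
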